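(* Let $M$ be a matroid, $\Gamma$ an ordered abelian group, $\psi\colon E(M)\to\Gamma$ a labeling, $F\subseteq\Gamma$ finite, and $B$ a basis of $M$. If $M$ has an $F$-avoiding basis, then it has an $F$-avoiding basis $B^*$ with $|B^*\setminus B|\le|F|$.
   Context: An abelian group $\Gamma$ is ordered if it carries a total order $\le$ such that $a\le b$ implies $a+c\le b+c$ for all $a,b,c$. $\psi(S):=\sum_{x\in S}\psi(x)$; a basis $B$ is $F$-avoiding if $\psi(B)\notin F$. *)

(* Defs.v *)
From HB Require Import structures.
From mathcomp Require Import all_boot all_order all_algebra.
From mathcomp Require Import finmap.
Set Implicit Arguments. Unset Strict Implicit. Unset Printing Implicit Defensive.
Import GRing.Theory.
Local Open Scope ring_scope.

Definition is_matroid (T : finType) (indep : pred {set T}) : Prop :=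
  [/\ indep set0,
      (forall A B : {set T}, B \subset A -> indep A -> indep B) &
      (forall A B : {set T}, indep A -> indep B -> (#|A| < #|B|)%N ->
          exists2 x, x \in B :\: A & indep (x |: A))].

Definition is_basis (T : finType) (indep : pred {set T}) (B : {set T}) : bool :=
  maxset indep B.

Definition ordered_abelian (G : zmodType) (le : rel G) : Prop :=
  [/\ reflexive le, antisymmetric le, transitive le, total le &
      (forall a b c : G, le a b -> le (a + c) (b + c))].

Definition psi_sum (T : finType) (G : zmodType) (psi : T -> G) (S : {set T}) : G :=
  \sum_(x in S) psi x.

Definition F_avoiding (T : finType) (G : zmodType) (psi : T -> G)
  (F : {fset G}) (B : {set T}) : bool :=
  psi_sum psi B \notin F.

(* Main.v *)
Require Import Defs.
From HB Require Import structures.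
From mathcomp Require Import all_boot all_order all_algebra.
From mathcomp Require Import finmap.
Open Scope fset_scope.

(** Choose an [F]-avoiding basis [B0] closest to [B]: every other basis [A] with
    [B :&: B0 \subset A \subset B :|: B0] then has its sum in [F], and one shows
    [#|B0 :\: B| <= #|F|] by induction on [#|B0 :\: B|], with [B0] fixed.
    If [B' = B - y + x] is a basis with [x] in [B0 - B] and [y] in [B - B0], the
    induction hypothesis for [B'] leaves room for improvement by one unless every
    value of [F] is attained by a basis that contains [x] and avoids [y].  Up to
    reversing the order, [psi B0] exceeds the minimum of [F].  Let [t] be the
    largest label on the symmetric difference of [B] and [B0].
    - Some [x] in [B0 - B] has label [t]: otherwise some [y] in [B - B0] has, and
      exchanging [y] into a basis of maximum sum avoiding [y] increases the sum.
    - No exchange [B0 - x' + z] preserves the sum, so the elements of label [t]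
      in [B - B0] are spanned by the elements of [B0] of smaller label; hence the
      elements of smaller label (with [B :&: B0]) span [M], and [x] can be
      exchanged for one of them in a minimum basis containing [x], which is
      absurd. *)

Set Implicit Arguments.
Unset Strict Implicit.
Unset Printing Implicit Defensive.

Import GRing.Theory.

(** * Bases and their exchange properties *)

Section Matroid.
Context {T : finType} {indep : pred {set T}} (mat : is_matroid indep).
Implicit Types (A B C I : {set T}) (x y z : T).

Lemma basis_indep A : is_basis indep A -> indep A.
Proof. exact: maxsetp. Qed.

Lemma indep_sub A B : B \subset A -> indep A -> indep B.
Proof. by case: mat => _ H _; exact: H. Qed.

Lemma indep_leq_card_basis I B :
  indep I -> is_basis indep B -> #|I| <= #|B|.
Proof.
move=> iI bB; case: mat => _ _ aug; rewrite leqNgt; apply/negP => lt.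
have [x] := aug _ _ (basis_indep bB) iI lt.
rewrite inE => /andP[xB _] ix.
by move: xB; rewrite -(maxsetsup bB ix (subsetUr _ _)) setU11.
Qed.

Lemma card_basis A B :
  is_basis indep A -> is_basis indep B -> #|A| = #|B|.
Proof.
by move=> bA bB; apply/eqP; rewrite eqn_leq !indep_leq_card_basis //;
  exact: basis_indep.
Qed.

Lemma indep_card_basis I B :
  is_basis indep B -> indep I -> #|B| <= #|I| -> is_basis indep I.
Proof.
move=> bB iI cI; apply/maxsetP; split=> // C iC sIC.
apply/esym/eqP; rewrite eqEcard sIC.
exact: leq_trans (indep_leq_card_basis iC bB) cI.
Qed.

Lemma indep_extend I B : indep I -> is_basis indep B ->
  exists C, [/\ is_basis indep C, I \subset C & C \subset I :|: B].
Proof.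
move=> iI bB; case: mat => _ _ aug.
have [|C /maxsetP[/andP[iC sC] maxC] sIC] :=
  @maxset_exists _ [pred C : {set T} | indep C && (C \subset I :|: B)] I.
  by rewrite /= iI subsetUl.
exists C; split=> //; apply: (indep_card_basis bB) => //.
rewrite leqNgt; apply/negP => lt.
have [x] := aug _ _ iC (basis_indep bB) lt; rewrite inE => /andP[xC xB] ix.
have eqC : x |: C = C.
  apply: maxC; last exact: subsetUr.
  by rewrite /= ix subUset sC sub1set inE xB orbT.
by move: xC; rewrite -eqC setU11.
Qed.

(** Extend [y |: A :&: B] to a basis inside [y |: A]: by cardinality it omits a single [z], which is
    not in [B] since [A :&: B] is kept. *)
Lemma basis_exchange_in A B y : is_basis indep A -> is_basis indep B ->
  y \in B :\: A -> exists2 z, z \in A :\: B & is_basis indep (y |: A :\ z).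
Proof.
move=> bA bB; rewrite inE => /andP[yA yB].
have iy : indep (y |: A :&: B).
  apply: indep_sub (basis_indep bB).
  by rewrite subUset sub1set yB subsetIr.
have [C [bC sIC sC]] := indep_extend iy bA.
have sCy : C \subset y |: A.
  by apply: subset_trans sC _; rewrite -setUA (setUidPr (subsetIl A B)).
have /subsetPn[z zyA zC] : ~~ (y |: A \subset C).
  apply/negP => /subset_leq_card.
  by rewrite cardsU1 yA (card_basis bC bA) ltnn.
have zy : z != y.
  by apply: contraNneq zC => ->; apply: (subsetP sIC); rewrite setU11.
have zA : z \in A by move: zyA; rewrite in_setU1 (negPf zy).
exists z.
  rewrite inE zA andbT; apply: contra zC => zB.
  by apply: (subsetP sIC); rewrite !inE zA zB orbT.
suff <- : C = y |: A :\ z by [].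
apply/eqP; rewrite eqEcard (card_basis bC bA); apply/andP; split.
  apply/subsetP => w wC; move: (subsetP sCy w wC); rewrite !inE.
  by case: (eqVneq w z) => [wz|//]; rewrite wz (negPf zC) in wC.
by rewrite cardsU1 !inE (negPf yA) andbF (cardsD1 z A) zA.
Qed.

Lemma basis_exchange_out A B x : is_basis indep A -> is_basis indep B ->
  x \in A -> x \notin B -> exists2 y, y \in B :\: A & is_basis indep (y |: A :\ x).
Proof.
move=> bA bB xA xB; case: mat => _ _ aug.
have cA : #|A| = #|A :\ x|.+1 by rewrite (cardsD1 x A) xA.
have [||y] := aug (A :\ x) B _ (basis_indep bB).
- exact: indep_sub (subsetDl _ _) (basis_indep bA).
- by rewrite -(card_basis bA bB) cA.
rewrite !inE negb_and negbK => /andP[yAx yB] iy.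
have yx : y != x by apply: contraNneq xB => <-.
rewrite (negPf yx) /= in yAx.
exists y; first by rewrite inE yAx yB.
apply: (indep_card_basis bA) => //.
by rewrite cardsU1 !inE (negPf yAx) andbF cA.
Qed.

End Matroid.

(** * Label sums, order, and bases between two given ones *)

Lemma psi_sum_exchange (T : finType) (G : zmodType) (psi : T -> G)
    (A : {set T}) x y : x \in A -> y \notin A ->
  psi_sum psi (y |: A :\ x) = (psi_sum psi A + (psi y - psi x))%R.
Proof.
move=> xA yA; rewrite /psi_sum big_setU1 ?inE ?(negPf yA) ?andbF //=.
by rewrite [in RHS](big_setD1 x) //= [RHS]addrC addrA subrK.
Qed.

Lemma exists_max (I : eqType) (G : zmodType) (le : rel G) (f : I -> G) (s : seq I) :
  ordered_abelian le -> s != [::] ->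
  exists2 i, i \in s & forall j, j \in s -> le (f j) (f i).
Proof.
case=> rle _ tle tot _; elim: s => // a [|b s] IH _.
  by exists a; [rewrite inE | move=> j; rewrite inE => /eqP->].
have [//|i iS iM] := IH.
have /orP[lai|lia] := tot (f a) (f i).
  exists i; first by rewrite inE iS orbT.
  by move=> j; rewrite inE => /orP[/eqP->|/iM].
exists a; first by rewrite inE eqxx.
by move=> j; rewrite inE => /orP[/eqP->|/iM lji] //; exact: tle lji lia.
Qed.

Lemma ordered_abelian_rev (G : zmodType) (le : rel G) :
  ordered_abelian le -> ordered_abelian (fun x y => le y x).
Proof.
case=> rle ale tle tot addle; split=> //.
- by move=> x y; rewrite andbC => /ale.
- by move=> y x z lxy lyz; exact: tle lyz lxy.
- by move=> a b c; exact: addle.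
Qed.

(** Such bases correspond to those of the minor that contracts [B :&: B0] and deletes everything
    outside [B :|: B0]; there [B] and [B0] become disjoint. *)
Definition between (T : finType) (B B0 A : {set T}) :=
  (B :&: B0 \subset A) && (A \subset B :|: B0).

Lemma between_exchange {T : finType} (B B0 A : {set T}) x y :
  between B B0 A -> x \notin B :&: B0 -> y \in B :|: B0 ->
  between B B0 (y |: A :\ x).
Proof.
move=> /andP[sA As] xI yU; apply/andP; split.
  apply/subsetP => w wI; rewrite !inE (subsetP sA w wI) andbT.
  by apply/orP; right; apply: contraNneq xI => <-.
by rewrite subUset sub1set yU (subset_trans (subsetDl _ _) As).
Qed.

(** Lets the induction pass from [B] to [x |: B :\ y]: the range of admissible bases only
    shrinks. *)
Lemma between_step (T : finType) (B B0 A : {set T}) x y :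
  x \in B0 -> y \notin B0 -> between (x |: B :\ y) B0 A -> between B B0 A.
Proof.
move=> xB0 yB0 /andP[IA AU]; apply/andP; split.
  apply: subset_trans IA; apply/subsetP => w; rewrite !inE => /andP[wB wB0].
  by rewrite wB wB0 (contraNneq _ yB0) ?orbT // => <-.
apply: subset_trans AU _; apply/subsetP => w; rewrite !inE.
by case/orP => [/orP[/eqP->|/andP[_ ->]]|->]; rewrite ?xB0 ?orbT.
Qed.

(** Strict inequality is the negation of the reverse [le], so exchanging in a strictly larger label
    strictly raises a sum. *)
Lemma ltDr {G : zmodType} {le : rel G} (s a b : G) : ordered_abelian le ->
  ~~ le b a -> ~~ le (s + (b - a))%R s.
Proof.
case=> _ _ _ _ addle; apply: contra => /(addle _ _ (a - s)%R).
by rewrite -addrA [((b - a) + _)%R]addrA subrK !(addrC s) !subrK.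
Qed.

(** * Extremal labels and extremal sums *)

Section Extremal.
Context {T : finType} {indep : pred {set T}} {G : zmodType} {le : rel G}.
Context {psi : T -> G} {F : {fset G}} {B B0 : {set T}}.
Local Notation Psi := (psi_sum psi).

Lemma small_labels_basis (t : G) :
  is_matroid indep -> is_basis indep B -> is_basis indep B0 ->
  (forall A, is_basis indep A -> between B B0 A -> A != B0 -> Psi A \in F) ->
  Psi B0 \notin F ->
  exists I, [/\ is_basis indep I, I \subset B :|: B0 &
    forall z, z \in I -> z \in (B :|: B0) :\: (B :&: B0) -> psi z != t].
Proof.
move=> mat bB bB0 badF B0F; case: (mat) => _ _ aug.
pose D := (B :|: B0) :\: (B :&: B0).
(* [S] drops from [B :|: B0] the elements of the symmetric difference with label [t]. A maximal
   independent subset [I] of [S] above [J] will be the basis. *)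
pose S := [set z in B :|: B0 | (z \in D) ==> (psi z != t)].
pose J := B0 :&: S.
have iJ : indep J by exact: (indep_sub mat (subsetIl _ _) (basis_indep bB0)).
have [|I /maxsetP[/andP[iI sI] maxI] sJI] :=
  @maxset_exists _ [pred C : {set T} | indep C && (C \subset S)] J.
  by rewrite /= iJ subsetIr.
exists I; split; last first.
- by move=> z zI zD; move: (subsetP sI z zI); rewrite inE [z \in D]zD => /andP[].
- by apply/subsetP => z zI; move: (subsetP sI z zI); rewrite inE => /andP[].
apply: (indep_card_basis mat bB) => //; rewrite leqNgt; apply/negP => lt.
have [z] := aug _ _ iI (basis_indep bB) lt; rewrite inE => /andP[zI zB] iz.
have zS : z \notin S.
  apply: contra zI => zS; rewrite -(maxI (z |: I)) ?setU11 ?subsetUr //=.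
  by rewrite iz subUset sub1set zS.
have [zD zt] : z \in D /\ psi z = t.
  by move: zS; rewrite inE inE zB /= negb_imply negbK => /andP[-> /eqP].
have zB0 : z \notin B0 by move: zD; rewrite !inE zB /= andbT.
(* A basis inside [z |: B0] that contains [z |: J] loses only one [x] of [B0] outside [J]. Both [x]
   and [z] have label [t], so it has the sum of [B0], outside [F]. *)
have iJz : indep (z |: J) by apply: (indep_sub mat) iz; exact: setUS.
have [C [bC sC Cs]] := indep_extend mat iJz bB0.
have zC : z \in C by apply: (subsetP sC); rewrite setU11.
have CB0 : C \subset z |: B0.
  by apply: subset_trans Cs _; rewrite -setUA (setUidPr (subsetIl _ _)).
have /subsetPn[x xB0 xC] : ~~ (B0 \subset C).
  apply/negP => s; have E : B0 == C by rewrite eqEcard s (card_basis mat bC bB0) leqnn.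
  by rewrite (eqP E) zC in zB0.
have xJ : x \notin J by apply: contra xC => xJ; apply: (subsetP sC); rewrite inE xJ orbT.
have [xD xt] : x \in D /\ psi x = t.
  by move: xJ; rewrite !inE xB0 !orbT /= negb_imply negbK => /andP[-> /eqP].
have eC : C = z |: B0 :\ x.
  apply/eqP; rewrite eqEcard; apply/andP; split.
    apply/subsetP => w wC; move: (subsetP CB0 w wC); rewrite !inE.
    by case: (eqVneq w x) => [wx|//]; rewrite wx (negPf xC) in wC.
  by rewrite (card_basis mat bC bB0) cardsU1 !inE (negPf zB0) andbF (cardsD1 x B0) xB0.
have : Psi C \in F.
  apply: badF => //; last by apply: contraNneq zB0 => <-.
  rewrite eC; apply: between_exchange.
  - by rewrite /between subsetIr subsetUr.
  - by move: xD; rewrite inE => /andP[].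
  - by rewrite inE zB.
by rewrite eC psi_sum_exchange // zt xt subrr addr0 (negPf B0F).
Qed.

(** Kept for an arbitrary order, so that the reversed order covers a [B0] whose sum is below [F]. As
    [le m (Psi B0)], a basis of sum [m] is minimum among all bases between [B] and [B0]. *)
Lemma value_not_attained m :
  is_matroid indep -> ordered_abelian le ->
  is_basis indep B -> is_basis indep B0 -> B != B0 ->
  (forall A, is_basis indep A -> between B B0 A -> A != B0 -> Psi A \in F) ->
  Psi B0 \notin F ->
  m \in F -> (forall f, f \in F -> le m f) -> le m (Psi B0) ->
  ~ (forall x y f, x \in B0 :\: B -> y \in B :\: B0 ->
      is_basis indep (x |: B :\ y) -> f \in F ->
      exists A, [/\ is_basis indep A, between B B0 A, x \in A, y \notin A
                  & Psi A = f]).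
Proof.
move=> mat ord bB bB0 neq badF B0F mF minm mB0 att.
case: (ord) => rle ale tle tot _.
pose D := (B :|: B0) :\: (B :&: B0).
have btwF A : is_basis indep A -> between B B0 A -> Psi A = Psi B0 \/ Psi A \in F.
  by move=> bA tA; case: (eqVneq A B0) => [->|/(badF A bA tA)]; [left|right].
have tB0 : between B B0 B0 by rewrite /between subsetIr subsetUr.
have [y0 y0B y0B0] : exists2 y, y \in B & y \notin B0.
  apply/subsetPn; apply: contra neq => s.
  by rewrite eqEcard s (card_basis mat bB bB0) leqnn.
have [|top topD topM] := @exists_max _ _ le psi (enum D) ord.
  have: y0 \in enum D by rewrite mem_enum !inE y0B (negPf y0B0).
  by case: (enum D).
rewrite mem_enum in topD.
have {}topM j : j \in D -> le (psi j) (psi top) by rewrite -mem_enum; exact: topM.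
have [x /andP[xB0 xB] xt] : exists2 x, (x \in B0) && (x \notin B) & psi x = psi top.
  case: (boolP (top \in B0)) => topB0.
    by exists top => //; move: topD; rewrite !inE topB0 orbT !andbT.
  have topB : top \in B by move: topD; rewrite !inE (negPf topB0) orbF => /andP[].
  (* The maximum is attained without [top]: either by [B0] itself, or by the basis that the last
     hypothesis supplies for the largest value of [F]. *)
  have [A [bA tA topA maxA]] : exists A, [/\ is_basis indep A, between B B0 A,
      top \notin A & forall C, is_basis indep C -> between B B0 C -> le (Psi C) (Psi A)].
    have [|M MF maxM] := @exists_max _ _ le id (enum_fset F) ord.
      by have : m \in enum_fset F := mF; case: (enum_fset F).
    have [x xD bx] := basis_exchange_out mat bB bB0 topB topB0.
    have topD0 : top \in B :\: B0 by rewrite inE topB0 topB.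
    have [A [bA tA _ topA PA]] := att _ _ _ xD topD0 bx MF.
    have /orP[l|l] := tot M (Psi B0).
      exists B0; split=> // C bC tC; have [->|CF] := btwF C bC tC; first exact: rle.
      exact: tle (maxM _ CF) l.
    exists A; split=> // C bC tC; rewrite PA; have [->//|CF] := btwF C bC tC.
    exact: maxM.
  have topBA : top \in B :\: A by rewrite inE topA topB.
  have [z] := basis_exchange_in mat bA bB topBA.
  rewrite inE => /andP[zB zA] bz.
  have zB0 : z \in B0.
    by case/andP: tA => _ /subsetP/(_ z zA); rewrite inE (negPf zB).
  exists z; first by rewrite zB0 zB.
  have zD : z \in D by rewrite !inE zB0 (negPf zB).
  apply: ale; rewrite topM //=; apply: contraT => lt.
  have := maxA _ bz; rewrite psi_sum_exchange // (negPf (ltDr _ ord lt)).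
  by apply; apply: between_exchange; rewrite // !inE ?(negPf zB) ?topB.
have xBD : x \in B0 :\: B by rewrite inE xB xB0.
have [y yD by_] := basis_exchange_in mat bB bB0 xBD.
have [A [bA tA xA _ PA]] := att _ _ _ xBD yD by_ mF.
have [I [bI sI It]] := small_labels_basis (psi top) mat bB bB0 badF B0F.
have xD : x \in D by rewrite !inE xB0 (negPf xB).
have xI : x \notin I by apply/negP => xI; move: (It x xI xD); rewrite xt eqxx.
have [z] := basis_exchange_out mat bA bI xA xI.
rewrite inE => /andP[zA zI] bz.
(* [A] contains [B :&: B0] but not [z], so [z] is in the symmetric difference and, lying in [I], has
   a label strictly below that of [x]. *)
have zx : z \notin B :&: B0 by apply: contra zA; case/andP: tA => /subsetP + _; exact.
have zD : z \in D by rewrite inE zx (subsetP sI).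
have lt : ~~ le (psi x) (psi z).
  by apply: contra (It z zI zD) => l; apply/eqP/ale; rewrite topM // -xt l.
have tz : between B B0 (z |: A :\ x).
  by apply: between_exchange; rewrite // ?(subsetP sI) // inE (negPf xB).
have Pz := psi_sum_exchange psi xA zA.
have : le (Psi A) (Psi (z |: A :\ x)).
  by rewrite PA; have [->//|/minm] := btwF _ bz tz.
rewrite Pz.
by apply/negP; exact: (ltDr _ (ordered_abelian_rev ord)).
Qed.

End Extremal.

(** [F] varies with [B] in the induction: one step towards [B0] that misses a value [f] allows [f]
    to be removed from [F], and both sides drop by one. *)
Lemma leq_card_setD_basis (T : finType) (indep : pred {set T}) (G : zmodType)
    (le : rel G) (psi : T -> G) (B0 : {set T}) :
  is_matroid indep -> ordered_abelian le -> is_basis indep B0 ->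
  forall (F : {fset G}) (B : {set T}), is_basis indep B ->
  (forall A, is_basis indep A -> between B B0 A -> A != B0 ->
     psi_sum psi A \in F) ->
  psi_sum psi B0 \notin F -> #|B0 :\: B| <= #|` F|.
Proof.
move=> mat ord bB0 F B; have [n] := ubnP #|B0 :\: B|.
elim: n F B => // n IH F B; rewrite ltnS => cn bB badF B0F.
rewrite leqNgt; apply/negP => ltF.
have neq : B != B0 by apply: contraTneq ltF => ->; rewrite setDv cards0.
(* [B] itself makes [F] nonempty, so that [F] has a minimum and a maximum. *)
have FB : psi_sum psi B \in F.
  by apply: badF => //; rewrite /between subsetIl subsetUl.
have att x y f : x \in B0 :\: B -> y \in B :\: B0 ->
    is_basis indep (x |: B :\ y) -> f \in F ->
    exists A, [/\ is_basis indep A, between B B0 A, x \in A, y \notin A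
                & psi_sum psi A = f].
  rewrite !inE => /andP[xB xB0] /andP[yB0 yB] bB' fF.
  pose B' := x |: B :\ y.
  (* A basis between [B'] and [B0] contains [x] and avoids [y], so it is as wanted if its sum is
     [f]; if none has sum [f], induction applies with [f] removed. *)
  pose Q A := [&& is_basis indep A, between B' B0 A & psi_sum psi A == f].
  have [/existsP[A /and3P[bA /andP[IA AU] /eqP PA]]|/existsPn none] :=
    boolP [exists A, Q A].
    exists A; split=> //.
    - by apply: (between_step xB0 yB0); rewrite /between IA AU.
    - by apply: (subsetP IA); rewrite !inE eqxx xB0.
    - apply/negP => /(subsetP AU); rewrite !inE eqxx (negPf yB0) /= !orbF => /eqP E.
      by rewrite -E yB in xB.
  have cB' : #|B0 :\: B| = #|B0 :\: B'|.+1.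
    rewrite (cardsD1 x (B0 :\: B)) inE xB xB0 add1n; congr _.+1; apply: eq_card => w.
    rewrite !inE negb_or negb_and negbK -!andbA; congr (_ && _).
    by case: (eqVneq w y) => [->|]; rewrite ?(negPf yB0) ?andbF.
  have : #|B0 :\: B'| <= #|` F `\ f|.
    apply: IH => //; first by rewrite -cB'.
      move=> A bA tA AB0; rewrite !inE; apply/andP; split.
        by move: (none A); rewrite /Q bA tA.
      by apply: badF => //; exact: between_step tA.
    by rewrite !inE (negPf B0F) andbF.
  by move: ltF; rewrite cB' (cardfsD1 f F) fF add1n ltnS ltnNge => /negPf->.
have Fne : enum_fset F != [::].
  by have : psi_sum psi B \in enum_fset F := FB; case: (enum_fset F).
have [M MF maxM] := exists_max id ord Fne.
have [m mF minm] := exists_max id (ordered_abelian_rev ord) Fne.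
case: (ord) => _ _ tle tot _.
have /orP[l|l] := tot m (psi_sum psi B0).
  by apply: (value_not_attained mat ord bB bB0 neq badF B0F mF minm l); exact: att.
apply: (value_not_attained mat (ordered_abelian_rev ord) bB bB0 neq badF B0F MF maxM).
  exact: tle l (maxM _ mF).
exact: att.
Qed.

Theorem theorem5p5 (T : finType) (indep : pred {set T}) (G : zmodType) (le : rel G)
    (psi : T -> G) (F : {fset G}) (B : {set T}) :
  is_matroid indep -> ordered_abelian le -> is_basis indep B ->
  (exists B0 : {set T}, is_basis indep B0 /\ F_avoiding psi F B0) ->
  exists Bs : {set T},
    [/\ is_basis indep Bs, F_avoiding psi F Bs & (#|Bs :\: B| <= #|` F|)%N].
Proof.
move=> mat ord bB [B1 [bB1 avB1]].
have P1 : is_basis indep B1 && F_avoiding psi F B1 by rewrite bB1.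
case: (@arg_minnP _ B1 (fun A => is_basis indep A && F_avoiding psi F A)
  (fun A => #|A :\: B|) P1) => B0 /andP[bB0 avB0] minB0.
exists B0; split=> //.
apply: (leq_card_setD_basis mat ord bB0 bB _ avB0) => A bA /andP[IA AU] neq.
apply: contraNT neq => avA.
(* Were [A] avoiding, minimality would give [A :\: B = B0 :\: B]; as [A] also contains [B :&: B0],
   it would contain [B0] and hence equal it. *)
have sA : A :\: B \subset B0 :\: B.
  apply/subsetP => w; rewrite !inE => /andP[wB wA]; rewrite wB.
  by move: (subsetP AU w wA); rewrite inE (negPf wB).
have E : A :\: B = B0 :\: B.
  by apply/eqP; rewrite eqEcard sA minB0 // bA.
rewrite eq_sym eqEcard (card_basis mat bA bB0) leqnn andbT.
apply/subsetP => w wB0; case: (boolP (w \in B)) => wB.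
  by apply: (subsetP IA); rewrite inE wB wB0.
by have: w \in A :\: B; [rewrite E inE wB wB0 | rewrite inE => /andP[]].
Qed.
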